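(* Let $R$ be a ring. The following statements are equivalent: (a) $R$ is right dual Kasch. (b) Every finitely generated projective right $R$-module $P$ is coneat in its injective hull $E(P)$. (c) $R$ (as a right $R$-module) is a coclosed submodule of $E(R)$. Moreover, if any of these conditions holds, then every projective simple right $R$-module is injective.
   Context: Rings are associative, unital and non-trivial; modules are unital right modules. $E(M)$ denotes the injective hull of a right module $M$, and $E(R)$ the injective hull of $R$ as a right $R$-module. A ring $R$ is right dual Kasch if every simple right $R$-module is isomorphic to a factor module of an injective right $R$-module. A submodule $N$ of a right $R$-module $M$ is coneat in $M$ if for every simple right $R$-module $S$, every homomorphism $N\to S$ can be extended to a homomorphism $M\to S$. A submodule $N$ of $M$ is coclosed in $M$ if, for each submodule $K$ of $N$, $N/K\ll M/K$ implies $K=N$; here $X\ll Y$ means that $X$ is a small (superfluous) submodule of $Y$, i.e. $X+Z=Y$ implies $Z=Y$ for every submodule $Z$ of $Y$. *)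

(* Defs.v *)
From HB Require Import structures.
From mathcomp Require Import all_boot all_order all_algebra.
From mathcomp Require Import boolp classical_sets.

Set Implicit Arguments.
Unset Strict Implicit.
Unset Printing Implicit Defensive.

Import GRing.Theory.
Local Open Scope ring_scope.
Local Open Scope quotient_scope.
Local Open Scope classical_set_scope.

(* MathComp only has left modules: a right R-module is a left module over the
   converse ring R^c, with x *: m standing for the product of m by x on the
   right.  The notions below are stated for left modules over a ring A and used
   with A := R^c.  Submodules are terms of submodClosed M; these are boolean
   predicates, and by the classical axioms of boolp every subset is one. *)
Notation rmodType R := (lmodType R^c).

(* The action of x in R^c on m is the product of x and m in R^c, i.e. m * x
   computed in R. *)
Definition rregular (R : nzRingType) : rmodType R := (R^c)^o.

Section Submodule.
Variables (A : nzRingType) (M : lmodType A) (N : submodClosed M).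

Definition submod : predArgType := {x : M | x \in N}.
HB.instance Definition _ := SubChoice.on submod.
HB.instance Definition _ := [SubChoice_isSubLmodule of submod by <:].

End Submodule.

Section Factor.
Variables (A : nzRingType) (M : lmodType A) (N : submodClosed M).

(* submodClosed does not inherit from zmodClosed, which Quotient.quot requires;
   submod_zmod is N seen as an additive subgroup. *)
Definition submod_pred : M -> bool := fun x => x \in N.

Fact submod_pred_closed : zmod_closed submod_pred.
Proof. exact: GRing.submod_closedB (submodClosedP N). Qed.

HB.instance Definition _ := GRing.isZmodClosed.Build M submod_pred
  submod_pred_closed.

Definition submod_zmod : zmodClosed M :=
  GRing.ZmodClosed.clone M submod_pred _.

Definition factor := Quotient.quot submod_zmod.
HB.instance Definition _ := GRing.Zmodule.on factor.
HB.instance Definition _ := EqQuotient.on factor.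

Definition proj (x : M) : factor := \pi_factor x.

Fact projE x y : (proj x == proj y) = (x - y \in N).
Proof. by rewrite -(Quotient.idealrBE submod_zmod). Qed.

Fact projD : {morph proj : x y / x + y}.
Proof. exact: (Quotient.pi_add submod_zmod). Qed.

Fact proj_reprK y : proj (repr y) = y.
Proof. exact: reprK. Qed.

Definition factor_scale (a : A) (y : factor) : factor := proj (a *: repr y).

Fact factor_scaleE a x : factor_scale a (proj x) = proj (a *: x).
Proof.
by apply/eqP; rewrite projE -scalerBr rpredZ // -projE proj_reprK.
Qed.

Fact factor_scaleA a b y :
  factor_scale a (factor_scale b y) = factor_scale (a * b) y.
Proof. by rewrite -[y]proj_reprK !factor_scaleE scalerA. Qed.

Fact factor_scale1 : left_id 1 factor_scale.
Proof. by move=> y; rewrite -[y]proj_reprK factor_scaleE scale1r. Qed.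

Fact factor_scaleDr : right_distributive factor_scale +%R.
Proof.
move=> a y z; rewrite -[y]proj_reprK -[z]proj_reprK.
by rewrite -projD !factor_scaleE -projD scalerDr.
Qed.

Fact factor_scaleDl y : {morph factor_scale^~ y : a b / a + b}.
Proof.
by move=> a b; rewrite -[y]proj_reprK !factor_scaleE -projD scalerDl.
Qed.

HB.instance Definition _ := GRing.Zmodule_isLmodule.Build A factor
  factor_scaleA factor_scale1 factor_scaleDr factor_scaleDl.

Fact proj_is_linear : linear proj.
Proof. by move=> a x y; rewrite projD -factor_scaleE. Qed.

HB.instance Definition _ := GRing.isLinear.Build A M factor *:%R proj
  proj_is_linear.

End Factor.

Section Image.
Variables (A : nzRingType) (M N : lmodType A) (f : {linear M -> N}).

Definition limage_pred : N -> bool := fun y => `[< exists x, f x = y >].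

Fact limage_pred_closed : subsemimod_closed limage_pred.
Proof.
split; first split.
- by apply/asboolP; exists 0; rewrite linear0.
- move=> _ _ /asboolP[x <-] /asboolP[y <-].
  by apply/asboolP; exists (x + y); rewrite linearD.
- move=> a _ /asboolP[x <-].
  by apply/asboolP; exists (a *: x); rewrite linearZ.
Qed.

HB.instance Definition _ := GRing.isSubmodClosed.Build A N limage_pred
  limage_pred_closed.

Definition limage : submodClosed N :=
  GRing.SubmodClosed.clone A N limage_pred _.

End Image.

Section Notions.
Variable A : nzRingType.

Definition surjective_map (U V : Type) (f : U -> V) := forall y, exists x, f x = y.

Definition isomorphic (M N : lmodType A) := exists f : {linear M -> N}, bijective f.

Definition simple_module (S : lmodType A) :=
  (exists x : S, x != 0) /\
  forall N : submodClosed S, N =i pred1 (0 : S) \/ N =i predT.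

Definition injective_module (E : lmodType A) :=
  forall (M N : lmodType A) (i : {linear M -> N}) (f : {linear M -> E}),
    injective i -> exists g : {linear N -> E}, forall x, g (i x) = f x.

Definition projective_module (P : lmodType A) :=
  forall (M N : lmodType A) (p : {linear M -> N}) (f : {linear P -> N}),
    surjective_map p -> exists g : {linear P -> M}, forall x, p (g x) = f x.

Definition finitely_generated (M : lmodType A) :=
  exists (n : nat) (e : 'I_n -> M),
    forall x, exists a : 'I_n -> A, x = \sum_(i < n) a i *: e i.

Definition essential (M : lmodType A) (N : submodClosed M) :=
  forall K : submodClosed M,
    (forall x, x \in N -> x \in K -> x = 0) -> K =i pred1 (0 : M).

(* The embedding is part of the data; M is identified with its image, the
   submodule limage hull_emb of the hull. *)
Record injective_hull (M : lmodType A) := InjectiveHull {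
  hull :> lmodType A;
  hull_emb : {linear M -> hull};
  hull_emb_inj : injective hull_emb;
  hull_injective : injective_module hull;
  hull_essential : essential (limage hull_emb)
}.

(* X is meant to be the underlying set of a submodule. *)
Definition small (M : lmodType A) (X : set M) :=
  forall Z : submodClosed M,
    [set x + z | x in X & z in [set` Z]] = [set: M] -> Z =i predT.

Definition coneat (M : lmodType A) (N : submodClosed M) :=
  forall S : lmodType A, simple_module S ->
  forall f : {linear submod N -> S},
  exists g : {linear M -> S}, forall x : submod N, g (val x) = f x.

(* For K included in N, the set proj K @` N is the submodule N/K of M/K. *)
Definition coclosed (M : lmodType A) (N : submodClosed M) :=
  forall K : submodClosed M, {subset K <= N} ->
    small (proj K @` [set` N]) -> K =i N.

End Notions.

Definition right_dual_kasch (R : nzRingType) :=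
  forall S : rmodType R, simple_module S ->
  exists E : rmodType R,
    injective_module E /\ exists K : submodClosed E, isomorphic S (factor K).

(* Main.v *)
Require Import Defs.
From HB Require Import structures.
From mathcomp Require Import all_boot all_order all_algebra.
From mathcomp Require Import boolp classical_sets functions.

Set Implicit Arguments.
Unset Strict Implicit.
Unset Printing Implicit Defensive.
Import GRing.Theory Num.Theory.
Local Open Scope ring_scope.

(** Why the theorem is true.  Write A for the ring over which modules are left
    modules (A is R^c in the end), e : A -> E for an injective hull of A, and
    identify A with its image in E.

    (a) => (b): if S is simple, choose p : I ->> S with I injective.  A map
    f : P -> S lifts through p because P is projective, the lift extends from
    P to its hull because I is injective, and composing with p extends f
    (coneat_projective).

    (b) => (c): let K be a proper submodule of A with A/K small in E/K.  It
    lies in a maximal submodule X of A, and A -> A/X extends to g : E -> A/X.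
    As g is onto already on A, A + ker g = E; both terms contain K, so smallness
    gives ker g = E, which is absurd (coneat_regular_coclosed).

    (c) => (a): let S be simple, s a nonzero element and K the annihilator of s,
    a proper left ideal.  Coclosedness provides a proper submodule W of E that
    contains K with A + W = E.  Hence E/W is a nonzero quotient of A/K = S, so
    it is S (coclosed_regular_kasch).

    The last step would be void if A had no injective hull, so most of the work
    is to build one.  Every abelian group V embeds into a divisible group D
    (divisible_embedding), and additive maps into a divisible group extend from
    subgroups (divisible_extension).  So the group of additive maps from A to D
    is an injective A-module (coinduced_injective), and it contains any module V
    through x |-> (r |-> r x).  Inside an injective module, a maximal essential
    extension of V is a retract, hence injective (injective_hull_exists).

    For the final claim, if (a) holds and S is simple and projective, then a
    surjection from an injective module onto S splits, and a retract of an
    injective module is injective. *)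

(** * Submodules and linear maps given by propositions *)

Lemma submod_of (A : nzRingType) (M : lmodType A) (S : M -> Prop) :
  S 0 -> (forall a x y, S x -> S y -> S (a *: x + y)) ->
  exists N : submodClosed M, forall x, x \in N <-> S x.
Proof.
move=> S0 Slin; pose P : {pred M} := fun x => `[< S x >].
have closedP : subsemimod_closed P.
  apply: GRing.submod_closed_semi; split=> [|a x y /asboolP Sx /asboolP Sy].
    exact/asboolP.
  by apply/asboolP/Slin.
pose N : submodClosed M := HB.pack P (GRing.isSubmodClosed.Build A M P closedP).
by exists N => x; split=> [/asboolP|Sx]//; apply/asboolP.
Qed.

Lemma subgroup_of (V : zmodType) (S : V -> Prop) :
  S 0 -> (forall x y, S x -> S y -> S (x - y)) ->
  exists N : submodClosed (zmodule V), forall x, x \in N <-> S x.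
Proof.
move=> S0 SB.
have SN x : S x -> S (- x) by move=> Sx; rewrite -sub0r; apply: SB.
have SD x y : S x -> S y -> S (x + y).
  by move=> Sx Sy; rewrite -[y]opprK; apply: SB => //; apply: SN.
have Sn x (n : nat) : S x -> S (x *+ n).
  by move=> Sx; elim: n => [|n IHn] //; rewrite mulrS; apply: SD.
apply: submod_of => // a x y Sx Sy; apply: SD => //.
rewrite scalezrE; case: (intP a) => [|n|n] //; first exact: Sn.
by rewrite mulrNz; apply/SN/Sn.
Qed.

Lemma linear_of (A : nzRingType) (U V : lmodType A) (f : U -> V) :
  (forall a x y, f (a *: x + y) = a *: f x + f y) ->
  exists g : {linear U -> V}, forall x, g x = f x.
Proof.
move=> flin.
pose g : {linear U -> V} := HB.pack f (GRing.isLinear.Build A U V *:%R f flin).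
by exists g.
Qed.

Lemma additive_of (U V : zmodType) (f : U -> V) :
  (forall x y, f (x + y) = f x + f y) ->
  exists g : {additive U -> V}, forall x, g x = f x.
Proof.
move=> fD.
have fB : zmod_morphism f.
  by move=> x y; apply/(addIr (f y)); rewrite -fD !subrK.
pose g : {additive U -> V} := HB.pack f (GRing.isZmodMorphism.Build U V f fB).
by exists g.
Qed.

Lemma submodN (A : nzRingType) (M : lmodType A) (N : submodClosed M) x :
  x \in N -> - x \in N.
Proof. by move=> xN; rewrite -scaleN1r rpredZ. Qed.

Lemma submodB (A : nzRingType) (M : lmodType A) (N : submodClosed M) x y :
  x \in N -> y \in N -> x - y \in N.
Proof. by move=> xN yN; rewrite rpredD ?submodN. Qed.

Lemma limageP (A : nzRingType) (M N : lmodType A) (f : {linear M -> N}) y :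
  y \in limage f <-> exists x, f x = y.
Proof. by split=> [/asboolP|?]//; apply/asboolP. Qed.

Lemma proj_eq (A : nzRingType) (M : lmodType A) (K : submodClosed M) x y :
  proj K x = proj K y <-> x - y \in K.
Proof. by rewrite -projE; split=> /eqP. Qed.

Lemma proj_eq0 (A : nzRingType) (M : lmodType A) (K : submodClosed M) x :
  proj K x = 0 <-> x \in K.
Proof. by rewrite -(linear0 (proj K)) proj_eq subr0. Qed.

Lemma corestrict (A : nzRingType) (M E : lmodType A) (X : submodClosed E)
    (f : {linear M -> E}) :
  (forall x, f x \in X) ->
  exists g : {linear M -> submod X}, forall x, val (g x) = f x.
Proof.
move=> fX; have [|g gE] := @linear_of A M (submod X)
    (fun x => exist (fun y => y \in X) _ (fX x)).
  by move=> a x y; apply: val_inj; rewrite /= linearP.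
by exists g => x; rewrite gE.
Qed.

Lemma factor_through (A : nzRingType) (M S T : lmodType A)
    (p : {linear M -> S}) (t : {linear M -> T}) :
  surjective_map p -> (forall x, p x = 0 -> t x = 0) ->
  exists u : {linear S -> T}, forall x, u (p x) = t x.
Proof.
move=> psurj pt; have [s sE] := choice psurj.
have tE x y : p x = p y -> t x = t y.
  move=> pxy; apply: subr0_eq; rewrite -linearB; apply: pt.
  by rewrite linearB pxy subrr.
have [|u uE] := @linear_of A S T (t \o s).
  by move=> a x y; rewrite /= -linearP; apply: tE; rewrite linearP !sE.
by exists u => x; rewrite uE; apply: tE; rewrite sE.
Qed.

(** * Zorn's lemma for submodules *)

(** Condition phi is imposed on the elements one by one, so it survives unions
    of chains.  This covers every maximality argument below: maximal
    extensions of a map (through its graph), maximal essential extensions,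
    maximal complements and maximal left ideals. *)
Lemma submod_zorn (A : nzRingType) (M : lmodType A) (B : submodClosed M)
    (phi : M -> Prop) :
  (forall x, x \in B -> phi x) ->
  exists X : submodClosed M,
    [/\ {subset B <= X}, forall x, x \in X -> phi x &
        forall Y : submodClosed M, {subset X <= Y} ->
          (forall x, x \in Y -> phi x) -> {subset Y <= X}].
Proof.
(* Chains in Zorn_bigcup may be empty, so each set S stands for its union with
   B. *)
move=> Bphi; pose up (S : set M) : set M := fun x => S x \/ x \in B.
pose P (S : set M) := exists2 N : submodClosed M,
  (forall x, x \in N <-> up S x) & forall x, x \in N -> phi x.
have [F FP Ftot|S [[X XS Xphi] Smax]] := @Zorn_bigcup M P; last first.
  exists X; split=> // [x xB|Y XY Yphi x xY]; first by apply/XS; right.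
  apply: contrapT => xX; apply: (Smax [set` Y]%classic).
    split=> [y Sy|]; first by apply/XY/XS; left.
    by move=> /(_ x xY) Sx; apply: xX; apply/XS; left.
  exists Y => // y; split=> [|[]//]; first by left.
  by move=> yB; apply/XY/XS; right.
have pick2 x y : up (\bigcup_(X in F) X)%classic x ->
    up (\bigcup_(X in F) X)%classic y ->
    x \in B /\ y \in B \/ exists2 S, F S & up S x /\ up S y.
  case=> [[S FS Sx]|xB] [[T FT Ty]|yB]; last by left.
  - have [ST|TS] := Ftot _ _ FS FT; right.
      by exists T => //; split; left=> //; apply: ST.
    by exists S => //; split; left=> //; apply: TS.
  - by right; exists S => //; split; [left|right].
  - by right; exists T => //; split; [right|left].
have [||N NE] := @submod_of A M (up (\bigcup_(X in F) X)%classic).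
- by right; apply: rpred0.
- move=> a x y Ux Uy; have [[xB yB]|[S FS [Sx Sy]]] := pick2 _ _ Ux Uy.
    by right; apply: rpredD => //; apply: rpredZ.
  have [N NE _] := FP _ FS.
  have : a *: x + y \in N by apply: rpredD; [apply: rpredZ|]; apply/NE.
  by case/NE=> [Sxy|]; [left; exists S|right].
exists N => // x /NE[[S FS Sx]|/Bphi//].
by have [N' N'E] := FP _ FS; apply; apply/N'E; left.
Qed.

(** * Divisible groups *)

Definition divisible (D : zmodType) :=
  forall (n : nat) (u : D), exists d, d *+ n.+1 = u.

(** Divisible groups are injective.  A partial extension of f is a subgroup of
    N * D that is the graph of a function, a condition on single elements by
    linearity.  A maximal one, G, is total: given y, let n be least positive
    with y *+ n in the domain, sent to u0 say.  Dividing u0 by n yields a value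
    for y that is consistent with G, as the multiples of y lying in the domain
    are those of y *+ n. *)
Lemma divisible_extension (D M N : zmodType) (i : {additive M -> N})
    (f : {additive M -> D}) :
  divisible D -> injective i -> exists g : {additive N -> D}, forall x, g (i x) = f x.
Proof.
move=> Ddiv iinj.
have [||G0 G0E] := @submod_of int (zmodule N * zmodule D)%type
    (fun p => exists x, p = (i x, f x)).
- by exists 0; rewrite !raddf0.
- move=> n _ _ [x ->] [y ->]; exists (x *~ n + y).
  by rewrite !raddfD !raddfMz.
have [|G [G0G Gfun Gmax]] := @submod_zorn _ _ G0 (fun p => p.1 = 0 -> p.2 = 0).
  move=> _ /G0E[x ->]/= ix0; have -> : x = 0 by apply: iinj; rewrite ix0 raddf0.
  by rewrite raddf0.
have Guniq y u v : (y, u) \in G -> (y, v) \in G -> u = v.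
  move=> yu yv; apply: subr0_eq.
  by apply: (Gfun _ (submodB yu yv)); apply: subrr.
have Gtotal (y : N) : exists d : D, (y, d) \in G.
  pose dom n := `[< (0 < n)%N /\ exists u : D, (y *+ n, u) \in G >].
  have [d dP] : exists d : D, forall (n : nat) (u : D),
      (y *+ n, u) \in G -> u = d *+ n.
    (* With no such multiple, consistency holds for any value, e.g. 0. *)
    have [exn|noN] := pselect (exists n, dom n); last first.
      exists 0 => n u yu; rewrite mul0rn; apply: (Gfun _ yu) => /=.
      case: n yu => [//|n] yu.
      by case: noN; exists n.+1; apply/asboolP; split=> //; exists u.
    case: (ex_minnP exn) => -[|n] /asboolP[//= _ [u0 yu0]] nmin.
    have [d du0] := Ddiv n u0; exists d => k u yu.
    have : (y *+ (k %% n.+1), u - u0 *+ (k %/ n.+1)) \in G.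
      have -> : y *+ (k %% n.+1) = y *+ k - y *+ n.+1 *+ (k %/ n.+1).
        by rewrite {2}(divn_eq k n.+1) mulrnDr mulnC mulrnA addrC addKr.
      exact: (submodB yu (rpredZ (Posz (k %/ n.+1)) yu0)).
    case kn : (k %% n.+1)%N => [|r] yr; last first.
      have : (n.+1 <= r.+1)%N.
        apply: nmin; apply/asboolP; split=> //.
        by exists (u - u0 *+ (k %/ n.+1)).
      by rewrite -kn leqNgt ltn_pmod.
    have /subr0_eq -> := Gfun _ yr erefl.
    by rewrite -du0 -mulrnA {2}(divn_eq k n.+1) kn addn0 mulnC.
  have dzP (k : int) u : (y *~ k, u) \in G -> u = d *~ k.
    case: (intP k) => [|n|n]; first exact: (dP 0%N).
      exact: dP.
    rewrite !mulrNz => /submodN yu; apply: oppr_inj; rewrite opprK.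
    by apply: dP; move: yu; congr (_ \in G); congr pair; rewrite /= opprK.
  (* G' extends G by y |-> d; maximality then puts (y, d) in G. *)
  have [||G' G'E] := @submod_of int (zmodule N * zmodule D)%type
    (fun p => exists x v k, (x, v) \in G /\ p = (x + y *~ k, v + d *~ k)).
  - by exists 0, 0, 0; split; [exact: rpred0|rewrite !mulr0z !addr0].
  - move=> n _ _ [x [v [k [xv ->]]]] [x' [v' [k' [xv' ->]]]].
    exists (x *~ n + x'), (v *~ n + v'), (k * n + k').
    split; first exact: (rpredD (rpredZ n xv) xv').
    congr pair; rewrite /= scalezrE mulrzDl mulrzDr mulrzA;
    by rewrite addrACA.
  have G'G : {subset G' <= G}.
    apply: Gmax => [[x v] xv|p /G'E[x [v [k [xv ->]]]]/= xyk].
      by apply/G'E; exists x, v, 0; split; rewrite // !mulr0z !addr0.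
    have /dzP <- : (y *~ k, - v) \in G.
      have := submodN xv; congr (_ \in G); congr pair.
      by apply/eqP; rewrite eq_sym -addr_eq0 addrC; apply/eqP.
    by rewrite subrr.
  exists d; apply/G'G/G'E; exists 0, 0, 1; split; first exact: rpred0.
  by rewrite !mulr1z !add0r.
have [|g gE] := @additive_of N D (fun y => sval (cid (Gtotal y))).
  move=> x y; case: cid => /= z xyz; case: cid => /= u xu; case: cid => /= v yv.
  exact: (Guniq _ _ _ xyz (rpredD xu yv)).
exists g => x; rewrite gE; case: cid => /= z xz; apply: (Guniq _ _ _ xz).
by apply/G0G/G0E; exists x.
Qed.

(** V is the quotient of the free abelian group on its elements by the relations
    between them.  Its quotient map becomes an embedding of V when the free
    group is enlarged to a rational vector space.  That space may be all of
    V -> rat, without finiteness condition: only the relation subgroup K must be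
    kept, whose elements are the formal differences of two sequences with the
    same sum. *)
Lemma divisible_embedding (V : zmodType) :
  exists (D : zmodType) (j : {additive V -> D}), divisible D /\ injective j.
Proof.
pose Q : zmodType := V -> rat.
pose diff (s t : seq V) : Q := fun x => (count_mem x s)%:R - (count_mem x t)%:R.
have [||K KE] := @subgroup_of Q (fun h => exists s t : seq V,
    \sum_(x <- s) x = \sum_(x <- t) x /\ h = diff s t).
- by exists [::], [::]; split=> //; apply: funext => x; rewrite /diff subrr.
- move=> _ _ [s [t [st ->]]] [s' [t' [st' ->]]]; exists (s ++ t'), (t ++ s').
  rewrite !big_cat /= st st'; split=> //; apply: funext => x.
  by rewrite /diff !fctE !count_cat !natrD opprB addrACA opprD.
pose e (x : V) : zmodule Q := diff [:: x] [::].
have [|j jE] := @additive_of V (factor K) (fun x => proj K (e x)).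
  move=> x y; rewrite -projD; apply/eqP; rewrite projE; apply/KE.
  exists [:: x + y], [:: x; y]; split.
    by rewrite !big_cons !big_nil !addr0.
  by apply: funext => z; rewrite /e /diff !fctE /= !addn0 !subr0 natrD.
exists (factor K), j; split.
  move=> n u; exists (proj K (fun x => (repr u : Q) x / n.+1%:R)).
  rewrite -raddfMn -[RHS]proj_reprK; congr proj; apply: funext => x.
  by rewrite natmulfctE -[LHS]mulr_natr divfK ?pnatr_eq0.
apply: raddf_inj => x; rewrite jE => /eqP; rewrite -[0](raddf0 (proj K)) projE subr0.
move=> /KE[s [t [st est]]].
(* If x is sent to 0, the point mass at x equals diff s t, so s and x :: t have
   the same multiplicities and hence the same sum. *)
have sE : perm_eq s (x :: t).
  apply/allP => z _ /=; move/(congr1 (fun h => h z)): est; rewrite /e /diff /= addn0 subr0.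
  by move/eqP; rewrite eq_sym subr_eq -natrD eqr_nat.
by move: st; rewrite (perm_big _ sE) big_cons => /eqP; rewrite -subr_eq0 addrK => /eqP.
Qed.

(** * Every module embeds into an injective one *)

Section Coinduced.
Variables (A : nzRingType) (D : zmodType).

Definition additive_pred : pred (A -> D) :=
  fun f => `[< forall x y, f (x + y) = f x + f y >].

Fact additive_pred_closed : zmod_closed additive_pred.
Proof.
split=> [|f g /asboolP fD /asboolP gD]; apply/asboolP => x y.
  by rewrite addr0.
by rewrite !fctE fD gD opprD addrACA.
Qed.

HB.instance Definition _ := GRing.isZmodClosed.Build (A -> D) additive_pred
  additive_pred_closed.

(** The group Hom_Z(A, D); right multiplication on the argument makes it a left
    A-module. *)
Definition coinduced : predArgType := {f : A -> D | f \in additive_pred}.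
HB.instance Definition _ := SubChoice.on coinduced.
HB.instance Definition _ := [SubChoice_isSubZmodule of coinduced by <:].

Lemma coinducedD (f : coinduced) x y : val f (x + y) = val f x + val f y.
Proof. by have /asboolP := valP f. Qed.

Lemma coinducedP (f g : coinduced) : (forall x, val f x = val g x) -> f = g.
Proof. by move=> fg; apply/val_inj/funext. Qed.

Fact coinduced_scale_subproof (a : A) (f : coinduced) :
  (fun x => val f (x * a)) \in additive_pred.
Proof. by apply/asboolP => x y; rewrite mulrDl coinducedD. Qed.

Definition coinduced_scale a f : coinduced :=
  exist (fun g => g \in additive_pred) _ (coinduced_scale_subproof a f).

Fact coinduced_scaleA a b f :
  coinduced_scale a (coinduced_scale b f) = coinduced_scale (a * b) f.
Proof. by apply: coinducedP => x /=; rewrite mulrA. Qed.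

Fact coinduced_scale1 : left_id 1 coinduced_scale.
Proof. by move=> f; apply: coinducedP => x /=; rewrite mulr1. Qed.

Fact coinduced_scaleDr : right_distributive coinduced_scale +%R.
Proof. by move=> a f g; apply: coinducedP. Qed.

Fact coinduced_scaleDl f : {morph coinduced_scale^~ f : a b / a + b}.
Proof.
by move=> a b; apply: coinducedP => x; rewrite /= mulrDr coinducedD.
Qed.

HB.instance Definition _ := GRing.Zmodule_isLmodule.Build A coinduced
  coinduced_scaleA coinduced_scale1 coinduced_scaleDr coinduced_scaleDl.

Lemma coinduced_of (h : A -> D) : (forall x y, h (x + y) = h x + h y) ->
  exists f : coinduced, forall x, val f x = h x.
Proof. by move=> /asboolP hD; exists (exist (fun g => g \in additive_pred) h hD). Qed.

(** Evaluation at 1 identifies A-linear maps N -> Hom_Z(A, D) with additive maps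
    N -> D, where extensions exist because D is divisible. *)
Lemma coinduced_injective : divisible D -> injective_module coinduced.
Proof.
move=> Ddiv M N i f iinj.
have [|f1 f1E] := @additive_of M D (fun x => val (f x) 1).
  by move=> x y; rewrite linearD.
have [g1 g1E] := divisible_extension f1 Ddiv iinj.
have /choice[g gE] (y : N) : exists u : coinduced, forall r, val u r = g1 (r *: y).
  by apply: coinduced_of => r s; rewrite scalerDl raddfD.
have [|h hE] := @linear_of A N coinduced g.
  move=> a x y; apply: coinducedP => r.
  have -> : val (a *: g x + g y) r = val (g x) (r * a) + val (g y) r by [].
  by rewrite !gE scalerDr raddfD scalerA.
exists h => x; apply: coinducedP => r.
by rewrite hE gE -linearZ g1E f1E linearZ /= mul1r.
Qed.

End Coinduced.

Lemma injective_embedding (A : nzRingType) (M : lmodType A) :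
  exists (E : lmodType A) (j : {linear M -> E}), injective_module E /\ injective j.
Proof.
have [D [d [Ddiv dinj]]] := divisible_embedding M.
have /choice[j jE] (x : M) :
    exists u : coinduced A D, forall r, val u r = d (r *: x).
  by apply: coinduced_of => r s; rewrite scalerDl raddfD.
have [|h hE] := @linear_of A M (coinduced A D) j.
  move=> a x y; apply: coinducedP => r.
  have -> : val (a *: j x + j y) r = val (j x) (r * a) + val (j y) r by [].
  by rewrite !jE scalerDr raddfD scalerA.
exists (coinduced A D), h; split; first exact: coinduced_injective.
move=> x y; rewrite !hE => /(congr1 (fun u => val u 1)).
by rewrite !jE !scale1r => /dinj.
Qed.

(** * Injective hulls *)

Lemma injective_retract (A : nzRingType) (E X : lmodType A)
    (s : {linear X -> E}) (r : {linear E -> X}) :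
  injective_module E -> cancel s r -> injective_module X.
Proof.
move=> Einj sK M N i f iinj; have [g gE] := Einj M N i (s \o f) iinj.
by exists (r \o g) => x; rewrite /= gE /= sK.
Qed.

(** Embed M into an injective E; let X be a maximal essential extension of M
    inside E and K a submodule of E maximal with K and X meeting in 0.
    Maximality of K makes X -> E/K an essential embedding, so the extension h
    of X -> E to E/K is injective and its image is essential over X.
    Maximality of X forces that image into X, and h composed with E -> E/K is a
    retraction of E onto X.  Essentiality is used in the form: every nonzero
    element has a nonzero multiple in the submodule. *)
Lemma injective_hull_exists (A : nzRingType) (M : lmodType A) :
  inhabited (injective_hull M).
Proof.
have [E [j [Einj jinj]]] := injective_embedding M.
have [|X [jX Xess Xmax]] := @submod_zorn A E (limage j)
    (fun x => x <> 0 -> exists a, a *: x \in limage j /\ a *: x <> 0).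
  by move=> x xj x0; exists 1; rewrite scale1r.
have [||O OE] := @submod_of A E (fun x => x = 0) => //.
  by move=> a _ _ -> ->; rewrite scaler0 addr0.
have [x /OE -> //|K [_ KX Kmax]] := @submod_zorn A E O (fun x => x \in X -> x = 0).
(* Otherwise K + A z would still meet X in 0. *)
have projK_ess z : z \notin K ->
    exists a x, [/\ x \in X, x <> 0 & proj K (a *: z) = proj K x].
  move=> zK; apply: contrapT => noax; case/negP: zK.
  have [||K' K'E] := @submod_of A E
      (fun y => exists k a, k \in K /\ y = k + a *: z).
  - by exists 0, 0; rewrite rpred0 scale0r addr0.
  - move=> b _ _ [k [a [kK ->]]] [l [c [lK ->]]].
    exists (b *: k + l), (b * a + c).
    by rewrite rpredD ?rpredZ // scalerDl scalerDr scalerA addrACA.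
  apply: (Kmax K') => [k kK|y /K'E[k [a [kK ->]]] yX|].
  - by apply/K'E; exists k, 0; rewrite scale0r addr0.
  - apply: contrapT => y0; apply: noax; exists a, (k + a *: z); split=> //.
    by apply/proj_eq; rewrite opprD addrCA subrr addr0 submodN.
  - by apply/K'E; exists 0, 1; rewrite rpred0 scale1r add0r.
have [|h hE] := Einj _ _ (proj K \o (val : submod X -> E)) (val : {linear submod X -> E}).
  move=> x y /= /proj_eq xyK; apply/val_inj/subr0_eq/KX => //.
  by apply: submodB; apply: valP.
have hX x : x \in X -> h (proj K x) = x.
  by move=> xX; apply: (hE (exist _ x xX)).
have himage y : h y \in X.
  apply: (Xmax (limage h)); last by apply/limageP; exists y.
    by move=> x xX; apply/limageP; exists (proj K x); apply: hX.
  move=> _ /limageP[z <-]; rewrite -[z]proj_reprK; move: (repr z) => {}z hz0.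
  have [|a [x [xX x0 azx]]] := @projK_ess z.
    by apply/negP => /proj_eq0 z0; apply: hz0; rewrite z0 linear0.
  have [b [bx bx0]] := Xess x xX x0.
  exists (b * a); rewrite -scalerA; suff -> : a *: h (proj K z) = x by [].
  by rewrite -(hX x xX) -azx !linearZ.
have [r rE] := corestrict (f := h \o proj K) (fun x => himage _).
have Xinj : injective_module (submod X).
  apply: (injective_retract (s := val) (r := r) Einj) => x.
  by apply: val_inj; rewrite rE; apply: hX; apply: valP.
have [e eE] := @corestrict A M E X j (fun x => jX _ (proj2 (limageP _ _) (ex_intro _ x erefl))).
have einj : injective e by move=> x y /(congr1 val); rewrite !eE => /jinj.
split; apply: (InjectiveHull einj Xinj) => L Le x.
apply/idP/eqP => [xL|->]; last exact: rpred0.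
apply: contrapT => x0.
have [|a [/limageP[m jm] ax0]] := Xess (val x) (valP x).
  by move=> vx0; apply: x0; apply: val_inj.
apply: ax0; suff /(congr1 val) : a *: x = 0 by [].
apply: Le; last exact: rpredZ.
by apply/limageP; exists m; apply: val_inj; rewrite eE.
Qed.

(** * Dual Kasch rings *)

Lemma isomorphic_of (A : nzRingType) (M N : lmodType A) (f : {linear M -> N}) :
  injective f -> surjective_map f -> isomorphic M N.
Proof.
move=> finj /choice[g fK]; exists f; exists g => // x.
by apply: finj; rewrite fK.
Qed.

Lemma dual_kasch_cover (A : nzRingType) (S : lmodType A) :
  (exists E : lmodType A,
    injective_module E /\ exists K : submodClosed E, isomorphic S (factor K)) ->
  exists (E : lmodType A) (p : {linear E -> S}),
    injective_module E /\ surjective_map p.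
Proof.
move=> [E [Einj [K [f [g fK gK]]]]].
have [|h hE] := @linear_of A (factor K) S g.
  by move=> a x y; apply: (can_inj fK); rewrite linearP !gK.
exists E, (h \o proj K); split=> // y; exists (repr (f y)).
by rewrite /= proj_reprK hE fK.
Qed.

Lemma coneat_projective (A : nzRingType) (P : lmodType A) (E : injective_hull P) :
  (forall S : lmodType A, simple_module S ->
    exists (I : lmodType A) (p : {linear I -> S}),
      injective_module I /\ surjective_map p) ->
  projective_module P -> coneat (limage (hull_emb E)).
Proof.
move=> kasch Pproj S Ssimple f; have [I [p [Iinj psurj]]] := kasch S Ssimple.
have [|e eE] := @corestrict A P E (limage (hull_emb E)) (hull_emb E).
  by move=> x; apply/limageP; exists x.
have [h hE] := Pproj _ _ p (f \o e) psurj.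
have [g gE] := Iinj _ _ _ h (@hull_emb_inj _ _ E).
exists (p \o g) => x; have /limageP[y yx] := valP x.
have -> : x = e y by apply: val_inj; rewrite eE.
by rewrite eE /= gE hE.
Qed.

Lemma regular_finitely_generated (A : nzRingType) :
  finitely_generated (A^o : lmodType A).
Proof.
exists 1%N, (fun=> 1) => x; exists (fun=> x).
by rewrite big_ord1 [RHS]mulr1.
Qed.

Lemma regular_projective (A : nzRingType) : projective_module (A^o : lmodType A).
Proof.
move=> M N p f psurj; have [m mE] := psurj (f 1).
have [|g gE] := @linear_of A A^o M (fun a => a *: m).
  by move=> a x y; rewrite scalerDl scalerA.
exists g => x; rewrite gE linearZ mE -linearZ; congr (f _); exact: mulr1.
Qed.

(** A submodule of A is proper iff it does not contain 1, a condition to which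
    submod_zorn applies; X is a maximal proper one. *)
Lemma simple_factor (A : nzRingType) (I : submodClosed (A^o : lmodType A)) :
  1 \notin I ->
  exists X : submodClosed (A^o : lmodType A),
    {subset I <= X} /\ simple_module (factor X).
Proof.
move=> I1; have [|X [IX X1 Xmax]] := @submod_zorn A A^o I (fun x => x != 1).
  by move=> x xI; apply: contraNneq I1 => <-.
exists X; split=> //; split.
  by exists (proj X 1); apply/negP => /eqP/proj_eq0/X1; rewrite eqxx.
move=> N; have [||Y YE] := @submod_of A A^o (fun x => proj X x \in N).
- by rewrite linear0 rpred0.
- by move=> a x y xN yN; rewrite linearP rpredD ?rpredZ.
have [Y1|Y1] := boolP (1 \in Y).
  right=> y; rewrite -[y]proj_reprK; apply/YE.
  by rewrite -[repr y]mulr1; apply: (rpredZ (repr y) Y1).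
left=> y; apply/idP/eqP => [yN|->]; last exact: rpred0.
rewrite -[y]proj_reprK; apply/proj_eq0/(Xmax Y).
- by move=> x /proj_eq0 x0; apply/YE; rewrite x0 rpred0.
- by move=> x xY; apply: contraNneq Y1 => <-.
by apply/YE; rewrite proj_reprK.
Qed.

Lemma coneat_regular_coclosed (A : nzRingType) (E : lmodType A)
    (e : {linear (A^o : lmodType A) -> E}) :
  injective e -> coneat (limage e) -> coclosed (limage e).
Proof.
move=> einj econeat K Ke Ksmall.
have [||I IE] := @submod_of A A^o (fun a => e a \in K).
- by rewrite linear0 rpred0.
- by move=> a x y xK yK; rewrite linearP rpredD ?rpredZ.
have [/IE I1|I1] := boolP (1 \in I).
  move=> y; apply/idP/idP => [/Ke //|/limageP[a <-]].
  by have := rpredZ a I1; rewrite -linearZ [a *: 1]mulr1.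
have [X [IX Xsimple]] := simple_factor I1.
have /choice[inv invE] (n : submod (limage e)) : exists a, e a = val n.
  by have /limageP := valP n.
have [|f fE] := @linear_of A (submod (limage e)) (factor X) (fun n => proj X (inv n)).
  by move=> a x y; rewrite -linearP; congr proj; apply: einj; rewrite linearP !invE.
have [g gE] := econeat _ Xsimple f.
have gen a : g (e a) = proj X a.
  have ea : e a \in limage e by apply/limageP; exists a.
  rewrite (gE (exist (fun x => x \in limage e) _ ea)) fE; congr proj; apply: einj; exact: invE.
(* Z is ker g modulo K; K is included in ker g since I is included in X. *)
have [||Z ZE] := @submod_of A (factor K) (fun y => exists2 x, y = proj K x & g x = 0).
- by exists 0; rewrite linear0.
- move=> a _ _ [x -> gx] [y -> gy].
  by exists (a *: x + y); rewrite linearP // gx gy scaler0 addr0.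
have gker x : proj K x \in Z -> g x = 0.
  move=> /ZE[y /proj_eq xyK gy]; rewrite -[x](subrK y) linearD gy addr0.
  have /limageP[a ea] := Ke _ xyK.
  by rewrite -ea gen; apply/proj_eq0/IX/IE; rewrite ea.
have Zall : Z =i predT.
  apply: Ksmall; apply/seteqP; split=> // y _; rewrite -[y]proj_reprK.
  move: (repr y) => {}y; have [a ga] : exists a, proj X a = g y.
    by exists (repr (g y)); rewrite proj_reprK.
  exists (proj K (e a)); first by exists (e a) => //; apply/limageP; exists a.
  exists (proj K (y - e a)); last by rewrite -linearD addrC subrK.
  by apply/ZE; exists (y - e a); rewrite // linearB gen ga subrr.
have [[y /eqP y0] _] := Xsimple; case: y0.
by rewrite -[y]proj_reprK -gen; apply: gker; rewrite Zall.
Qed.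

Lemma coclosed_regular_kasch (A : nzRingType) (E : lmodType A)
    (e : {linear (A^o : lmodType A) -> E}) (S : lmodType A) :
  injective e -> coclosed (limage e) -> simple_module S ->
  exists K : submodClosed E, isomorphic S (factor K).
Proof.
move=> einj ecoclosed [[s s0] Ssub].
have [|p pE] := @linear_of A A^o S (fun a => a *: s).
  by move=> a x y; rewrite scalerDl scalerA.
have psurj : surjective_map p.
  move=> y; apply/limageP; have [/(_ s)|-> //] := Ssub (limage p).
  rewrite inE (negbTE s0) => /negP[]; apply/limageP.
  by exists 1; rewrite pE scale1r.
have [||K KE] := @submod_of A E (fun x => exists2 a, e a = x & p a = 0).
- by exists 0; rewrite linear0.
- move=> a _ _ [x <- px] [y <- py].
  by exists (a *: x + y); rewrite linearP // px py scaler0 addr0.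
have Ke : {subset K <= limage e} by move=> x /KE[a <- _]; apply/limageP; exists a.
(* K is not the whole of A, as it misses 1: a multiple of s by 1 is s. *)
have /existsNP[Z /not_implyP[ZE Zproper]] : ~ small (proj K @` [set` limage e])%classic.
  move=> /(ecoclosed K Ke)/(_ (e 1)).
  have -> : e 1 \in limage e by apply/limageP; exists 1.
  move=> /KE[a /einj-> p1]; case/eqP: s0.
  by rewrite -(scale1r s) -pE.
have [||W WE] := @submod_of A E (fun x => proj K x \in Z).
- by rewrite linear0 rpred0.
- by move=> a x y xZ yZ; rewrite linearP rpredD ?rpredZ.
have esurj y : exists a, proj W (e a) = y.
  rewrite -[y]proj_reprK; move: (repr y) => {}y.
  have : [set: factor K]%classic (proj K y) by [].
  rewrite -ZE => -[_ [_ /limageP[a <-] <-]] [z /= zZ eaz].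
  exists a; apply/proj_eq/WE.
  by rewrite linearB /= -eaz opprD addrA subrr add0r submodN.
have [u uE] : exists u : {linear S -> factor W}, forall a, u (p a) = proj W (e a).
  apply: (factor_through (t := proj W \o e) psurj) => a pa.
  apply/proj_eq0/WE; have -> : proj K (e a) = 0; last exact: rpred0.
  by apply/proj_eq0/KE; exists a.
exists W; apply: (isomorphic_of (f := u)); last first.
  by move=> y; have [a <-] := esurj y; exists (p a).
(* The kernel of u is 0 or S, and it is not S because W is proper. *)
have [||N NE] := @submod_of A S (fun x => u x = 0).
- exact: linear0.
- by move=> a x y ux uy; rewrite linearP ux uy scaler0 addr0.
apply: raddf_inj => x; have [N0|NT] := Ssub N.
  by move=> /NE; rewrite N0 inE => /eqP.
case: Zproper => z; rewrite -[z]proj_reprK; apply/WE/proj_eq0.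
have [a <-] := esurj (proj W (repr z)); rewrite -uE.
by apply/NE; rewrite NT.
Qed.

Lemma projective_kasch_injective (A : nzRingType) (E S : lmodType A) (p : {linear E -> S}) :
  injective_module E -> surjective_map p -> projective_module S -> injective_module S.
Proof.
move=> Einj psurj Sproj; have [s sK] := Sproj _ _ p idfun psurj.
exact: injective_retract Einj sK.
Qed.

Theorem theorem2p3 (R : nzRingType) :
  let a := right_dual_kasch R in
  let b := forall P : rmodType R, finitely_generated P -> projective_module P ->
           forall E : injective_hull P, coneat (limage (hull_emb E)) in
  let c := forall E : injective_hull (rregular R),
           coclosed (limage (hull_emb E)) in
  [<-> a; b; c] /\
  (a \/ b \/ c ->
   forall S : rmodType R,
     projective_module S -> simple_module S -> injective_module S).
Proof.
move=> a b c.
have cover : a -> forall S : rmodType R, simple_module S ->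
    exists (I : rmodType R) (p : {linear I -> S}),
      injective_module I /\ surjective_map p.
  by move=> ha S /ha; apply: dual_kasch_cover.
have ab : a -> b by move=> /cover ha P _ Pproj E; apply: coneat_projective.
have bc : b -> c.
  move=> hb E; apply: coneat_regular_coclosed; first exact: hull_emb_inj.
  by apply: hb; [apply: regular_finitely_generated|apply: regular_projective].
have ca : c -> a.
  move=> hc S Ssimple; have [E] := injective_hull_exists (rregular R).
  exists E; split; first exact: hull_injective.
  exact: (coclosed_regular_kasch (@hull_emb_inj _ _ E) (hc E) Ssimple).
split; first by tfae.
move=> abc; have {abc}/cover ha : a by case: abc => [|[/bc|]] //; apply: ca.
move=> S Sproj /ha[E [p [Einj psurj]]].
exact: projective_kasch_injective Einj psurj Sproj.
Qed.
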